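(* Let $T_n\in\mathbb{R}^{n\times n}$, $y_n,y_n^\delta\in\mathbb{R}^n$ with $\|y_n-y_n^\delta\|_2\le\delta$, let $x_n^\dagger=T_n^\dagger y_n$, let $i\ge 1$ be an integer, let $T_n^{(\ell)}$ be the Arnoldi approximation of $T_n$ obtained from $\ell$ steps of the Arnoldi process (without breakdown) with initial vector $y_n^\delta$, let $h_\ell\ge0$ satisfy $\|T_n-T_n^{(\ell)}\|_2\le h_\ell$, and let $x_{\alpha,n,i}^{\delta,\ell}$ denote the iterated Arnoldi-Tikhonov solution, all as defined in the context. Set $C=1$ and $E=\|x_n^\dagger\|_2$, assume that $$0\le E h_\ell+C\delta\le \|\mathcal{R}_\ell y_n^\delta\|_2 ,$$ assume that at least one of the first $\ell$ entries of $\hat y_{\ell+1}^\delta$ is nonzero, and let $\alpha>0$ be the unique solution of $$\alpha^{2i+1}(\hat y_{\ell+1}^\delta)^{*}\bigl(\Sigma_{\ell+1,\ell}\Sigma_{\ell+1,\ell}^{*}+\alpha I_{\ell+1}\bigr)^{-2i-1}\hat y_{\ell+1}^\delta=(E h_\ell+C\delta)^2 .$$ Moreover, for some $\nu\ge0$ and $\rho>0$, let $x_n^\dagger\in\mathcal{X}_{n,\nu,\rho}$, i.e. $x_n^\dagger=(T_n^{*}T_n)^{\nu}w_n$ with $w_n\in\ker(T_n)^\perp$ and $\|w_n\|_2\le\rho$. Then, as $h_\ell+\delta\to0$, $$\|x_n^{\dagger}-x_{\alpha,n,i}^{\delta,\ell}\|_2= \begin{cases} o(1) &\text{if } \nu=0,\\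 o\bigl((h_{\ell}+\delta)^{\frac{2\nu i}{2\nu i+1}}\bigr)+O\bigl(\gamma_{\ell}^{2\nu}\|w_n\|_2\bigr)&\text{if } 0<\nu<1,\\ O\bigl((h_{\ell}+\delta)^{\frac{2i}{2i+1}}\bigr)+O\bigl(\gamma_{\ell}\|(I_n-\mathcal{R}_{\ell})T_nw_n\|_2\bigr) &\text{if } \nu=1, \end{cases}$$ where $\gamma_\ell=\|(I_n-\mathcal{R}_\ell)T_n\|_2$.
   Context: $\|\cdot\|_2$ is the Euclidean vector norm and the induced (spectral) matrix norm; ${}^*$ is transposition; $I_k$ is the $k\times k$ identity; $T_n^\dagger$ is the Moore-Penrose pseudoinverse of $T_n$ (which need not be invertible). Arnoldi decomposition: let $1\le\ell<n$. Applying $\ell$ steps of the Arnoldi process to $T_n$ with initial vector $y_n^\delta$ gives $T_nV_{n,\ell}=V_{n,\ell+1}H_{\ell+1,\ell}$, where the columns of $V_{n,\ell+1}=[V_{n,\ell}\mid v^{(\ell+1)}_{n,\ell+1}]\in\mathbb{R}^{n\times(\ell+1)}$ form an orthonormal basis of the Krylov space $\mathcal{K}_{\ell+1}(T_n,y_n^\delta)=\mathrm{span}\{y_n^\delta,T_ny_n^\delta,\dots,T_n^{\ell}y_n^\delta\}$ and $H_{\ell+1,\ell}\in\mathbb{R}^{(\ell+1)\times\ell}$ is upper Hessenberg. It is assumed that the process does not break down, so $H_{\ell+1,\ell}$ has full rank $\ell$. The Arnoldi approximation is $T_n^{(\ell)}=V_{n,\ell+1}H_{\ell+1,\ell}V_{n,\ell}^{*}\in\mathbb{R}^{n\times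 n}$ (equivalently $T_n^{(\ell)}=T_nV_{n,\ell}V_{n,\ell}^*$). Iterated Arnoldi-Tikhonov (iAT) solution: for $\alpha>0$ and integer $i\ge1$, $$x_{\alpha,n,i}^{\delta,\ell}=\sum_{k=1}^{i}\alpha^{k-1}(T_n^{(\ell)*}T_n^{(\ell)}+\alpha I_n)^{-k}T_n^{(\ell)*}y_n^\delta .$$ Projector and SVD: $\mathcal{R}_\ell$ is the orthogonal projector of $\mathbb{R}^n$ onto the range of $T_n^{(\ell)}$. Let $H_{\ell+1,\ell}=U_{\ell+1}\Sigma_{\ell+1,\ell}S_\ell^{*}$ be a singular value decomposition, with $U_{\ell+1}\in\mathbb{R}^{(\ell+1)\times(\ell+1)}$, $S_\ell\in\mathbb{R}^{\ell\times\ell}$ orthogonal and $\Sigma_{\ell+1,\ell}\in\mathbb{R}^{(\ell+1)\times\ell}$ diagonal with nonincreasing singular values. Let $I_{\ell,\ell+1}=\begin{bmatrix}I_\ell&0\\0&0\end{bmatrix}\in\mathbb{R}^{(\ell+1)\times(\ell+1)}$, $y_{\ell+1}^\delta=V_{n,\ell+1}^{*}y_n^\delta$ and $\hat y_{\ell+1}^\delta=I_{\ell,\ell+1}U_{\ell+1}^{*}y_{\ell+1}^\delta$. Asymptotic convention: $n$, $T_n$, $y_n$, $x_n^\dagger$, $w_n$, $\nu$, $i$ are fixed, while $\delta$, $y_n^\delta$, $\ell$, $h_\ell$ (hence $V_{n,\ell+1}$, $H_{\ell+1,\ell}$, $\mathcal{R}_\ell$, $\alpha$) vary subject to the stated hypotheses;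 the $o$ and $O$ symbols refer to $h_\ell+\delta\to0$. *)

(* Defs.v *)
From HB Require Import structures.
From mathcomp Require Export all_boot all_order all_algebra.
From mathcomp Require Export all_classical all_reals all_analysis.

Set Implicit Arguments.
Unset Strict Implicit.
Unset Printing Implicit Defensive.

Import Order.TTheory GRing.Theory Num.Theory.
Import numFieldNormedType.Exports.

Local Open Scope classical_set_scope.
Local Open Scope ring_scope.

Section EuclideanLinearAlgebra.
Context {R : realType}.

(* The library norm on matrices is the sup norm, hence these two definitions. *)
Definition norm2 n (x : 'cV[R]_n) : R := Num.sqrt (\sum_(i < n) x i 0 ^+ 2).

Definition opnorm2 m n (A : 'M[R]_(m, n)) : R :=
  sup [set norm2 (A *m x) | x in [set x : 'cV[R]_n | norm2 x <= 1]].

Definition moore_penrose m n (A : 'M[R]_(m, n)) (X : 'M[R]_(n, m)) : Prop :=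
  [/\ A *m X *m A = A, X *m A *m X = X,
      (A *m X)^T = A *m X & (X *m A)^T = X *m A].

(* [%MS] compares row spaces, hence the transposes in this section. *)
Definition orthogonal_projector_onto_range m n
    (A : 'M[R]_(m, n)) (P : 'M[R]_m) : Prop :=
  [/\ P *m P = P, P^T = P & (P^T == A^T)%MS].

Definition orthonormal_columns m n (Q : 'M[R]_(m, n)) : Prop :=
  Q^T *m Q = 1%:M.

(* B = A^s for A symmetric positive semidefinite and s >= 0, by spectral
   calculus; the result does not depend on the diagonalisation. Since
   [0 `^ 0 = 1], A^0 is the identity. *)
Definition psd_rpow n (A : 'M[R]_n) (s : R) (B : 'M[R]_n) : Prop :=
  exists (Q : 'M[R]_n) (d : 'rV[R]_n),
    [/\ orthonormal_columns Q, (forall j, 0 <= d 0 j),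
        A = Q *m diag_mx d *m Q^T
      & B = Q *m diag_mx (map_mx (fun t => t `^ s) d) *m Q^T].

(* x = (T^* T)^nu w with w in ker(T)^perp and |w| <= rho. *)
Definition source_condition n (T : 'M[R]_n) (nu rho : R)
    (w x : 'cV[R]_n) : Prop :=
  [/\ (exists2 P, psd_rpow (T^T *m T) nu P & x = P *m w),
      (forall z : 'cV[R]_n, T *m z = 0 -> z^T *m w = 0)
    & norm2 w <= rho].

Definition singular_value_decomposition l (H : 'M[R]_(l.+1, l))
    (U : 'M[R]_l.+1) (Sg : 'M[R]_(l.+1, l)) (S : 'M[R]_l) : Prop :=
  [/\ H = U *m Sg *m S^T,
      orthonormal_columns U /\ orthonormal_columns S,
      (forall (i : 'I_l.+1) (j : 'I_l), i != j :> nat -> Sg i j = 0),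
      (forall (i : 'I_l.+1) (j : 'I_l), i = j :> nat -> 0 <= Sg i j)
    & (forall (i i' : 'I_l.+1) (j j' : 'I_l), i = j :> nat ->
         i' = j' :> nat -> (j <= j')%N -> Sg i' j' <= Sg i j)].

End EuclideanLinearAlgebra.

Section Arnoldi.
Context {R : realType} {n : nat}.
Implicit Types (T : 'M[R]_n) (y : 'cV[R]_n).

Definition krylov_mx T y k : 'M[R]_(n, k) :=
  \matrix_(r < n, j < k) (T ^+ j *m y) r 0.

Definition drop_last_col l (V : 'M[R]_(n, l.+1)) : 'M[R]_(n, l) :=
  colsub (widen_ord (leqnSn l)) V.

(* Outcome of l steps of the Arnoldi process without breakdown. As K_{l+1} has
   dimension l+1, these conditions force the subdiagonal of H to be nonzero and
   determine (V, H) up to the signs of the columns of V after the first; the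
   usual normalisation makes the subdiagonal positive. The Arnoldi
   approximation does not depend on these signs. *)
Record arnoldi T y l (V : 'M[R]_(n, l.+1)) (H : 'M[R]_(l.+1, l)) : Prop := {
  arnoldi_start : norm2 y *: col ord0 V = y;
  arnoldi_relation : T *m drop_last_col V = V *m H;
  arnoldi_orthonormal : orthonormal_columns V;
  arnoldi_krylov : (V^T == (krylov_mx T y l.+1)^T)%MS;
  arnoldi_hessenberg :
    forall (i : 'I_l.+1) (j : 'I_l), (j.+1 < i)%N -> H i j = 0;
  arnoldi_no_breakdown : \rank H = l
}.

Definition arnoldi_approx l (V : 'M[R]_(n, l.+1)) (H : 'M[R]_(l.+1, l)) :
    'M[R]_n :=
  V *m H *m (drop_last_col V)^T.

Definition iterated_tikhonov (A : 'M[R]_n) y (alpha : R) (i : nat) :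
    'cV[R]_n :=
  \sum_(1 <= k < i.+1)
    alpha ^+ k.-1 *: ((invmx (A^T *m A + alpha%:M)) ^+ k *m A^T *m y).

End Arnoldi.

(* The quantities that vary in the asymptotic statement. *)
Record iat_data (R : realType) (n : nat) := IATData {
  d_delta : R;
  d_y : 'cV[R]_n;
  d_l : nat;
  d_h : R;
  d_V : 'M[R]_(n, d_l.+1);
  d_H : 'M[R]_(d_l.+1, d_l);
  d_U : 'M[R]_(d_l.+1);
  d_Sigma : 'M[R]_(d_l.+1, d_l);
  d_S : 'M[R]_d_l;
  d_proj : 'M[R]_n;
  d_alpha : R
}.

Section IteratedArnoldiTikhonov.
Context {R : realType} {n : nat}.
Implicit Type d : iat_data R n.

Definition d_T d : 'M[R]_n := arnoldi_approx (d_V d) (d_H d).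

Definition d_yhat d : 'cV[R]_((d_l d).+1) :=
  pid_mx (d_l d) *m (d_U d)^T *m ((d_V d)^T *m d_y d).

Definition d_x (i : nat) d : 'cV[R]_n :=
  iterated_tikhonov (d_T d) (d_y d) (d_alpha d) i.

Definition d_gamma (T : 'M[R]_n) d : R := opnorm2 ((1%:M - d_proj d) *m T).

Record admissible (T : 'M[R]_n) (y : 'cV[R]_n) (E C : R) (i : nat) d : Prop := {
  adm_noise : norm2 (y - d_y d) <= d_delta d;
  adm_l : (1 <= d_l d < n)%N;
  adm_arnoldi : arnoldi T (d_y d) (d_V d) (d_H d);
  adm_h_ge0 : 0 <= d_h d;
  adm_h : opnorm2 (T - d_T d) <= d_h d;
  adm_svd : singular_value_decomposition (d_H d) (d_U d) (d_Sigma d) (d_S d);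
  adm_proj : orthogonal_projector_onto_range (d_T d) (d_proj d);
  adm_level : 0 <= E * d_h d + C * d_delta d <= norm2 (d_proj d *m d_y d);
  adm_yhat : exists j : 'I_(d_l d).+1, (j < d_l d)%N /\ d_yhat d j 0 != 0;
  adm_alpha_gt0 : 0 < d_alpha d;
  adm_alpha :
    d_alpha d ^+ (2 * i + 1) *
      ((d_yhat d)^T *m
       (invmx (d_Sigma d *m (d_Sigma d)^T + (d_alpha d)%:M)) ^+ (2 * i + 1) *m
       d_yhat d) 0 0
    = (E * d_h d + C * d_delta d) ^+ 2
}.

(* The filter "h + delta --> 0 along admissible data"; eventual properties, and
   the constants hidden in O, are thus uniform in all the varying data. *)
Definition vanishing_noise (T : 'M[R]_n) (y : 'cV[R]_n) (E C : R) (i : nat) :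
    set_system (iat_data R n) :=
  filter_from [set e : R | 0 < e]
    (fun e => [set d | admissible T y E C i d /\ d_h d + d_delta d < e]).

Global Instance vanishing_noise_filter T y E C i :
  Filter (vanishing_noise T y E C i).
Proof.
apply: filter_from_filter; first by exists 1; rewrite /= ltr01.
move=> e1 e2 /= e1_gt0 e2_gt0; exists (Num.min e1 e2) => /=.
  by rewrite lt_min e1_gt0.
by move=> d [/= ad]; rewrite lt_min => /andP[].
Qed.

Canonical vanishing_noise_filter_on T y E C i :=
  FilterType (vanishing_noise T y E C i) (vanishing_noise_filter T y E C i).

End IteratedArnoldiTikhonov.

(* Main.v *)
From mathcomp Require Import ring lra.
Require Import Defs.

(** Why the theorem holds.  The matrix [T] is fixed, so its nonzero singular
values are bounded away from 0; writing [P = T Tdag] for the orthogonal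
projector onto the range of [T], this says [|u| <= |Tdag| |T^T u|] for every
[u] with [P u = u].  The Arnoldi approximation is [A = T V_l V_l^T], so its
range lies in that of [T], and once [h] is small [A^T] inherits the bound on the
whole range of [T] ([range_coercive_perturb]).  On that subspace [K = A A^T] is
therefore uniformly invertible, which makes the problem well posed: a single
rate [O((h + delta)^(2i/(2i+1)))] covers the three cases
([iat_error_rate]).  For [nu = 1] it is the first term of the claim, for
[nu < 1] it is [o] of the first term because its exponent is strictly larger,
and the remainder [e2] can be taken to be 0.

The rate comes from working on the image side.  The solution is [A^T u] with
[u = sum_k a^(k-1) (K + a)^-k P yd], and [K u = P yd - B^i P yd] with
[B = a (K + a)^-1] by telescoping.  The exact solution is [T^T z] with
[z = Tdag^T xdag], and [T T^T z = P y].  Hence [K (z - u)] is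
[B^i P yd + O(h + delta)], and inverting [K] on the range of [T] gives
[|xdag - x| <= C (h + delta + |B^i P yd|)] ([iterated_tikhonov_error]).

It remains to bound the residual [B^i P yd] ([residual_rate]), which is at most
[min(1, kappa a)^i |P yd|].  If [T^T y = 0] then [P y = 0] and
[|P yd| = O(delta)].  Otherwise [A^T yd] is close to [T^T y], which keeps
[yhat] away from 0; since [Sigma Sigma^T + a] is diagonal with entries at most
[|A|^2 + a], the equation that defines [a] forces
[(a / (|A|^2 + a))^(2i+1) = O((h + delta)^2)], so
[a = O((h + delta)^(2/(2i+1)))], and the [i]-th power of this is the rate. *)

Import Order.TTheory GRing.Theory Num.Theory.
Import numFieldNormedType.Exports.

Local Open Scope classical_set_scope.
Local Open Scope ring_scope.

Set Implicit Arguments.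
Unset Strict Implicit.
Unset Printing Implicit Defensive.

(** * Euclidean and Frobenius norms *)

Definition dotv (R : realType) n (x y : 'cV[R]_n) : R := (x^T *m y) 0 0.

Lemma dotvE (R : realType) n (x y : 'cV[R]_n) :
  dotv x y = \sum_(j < n) x j 0 * y j 0.
Proof. by rewrite /dotv mxE; apply: eq_bigr => j _; rewrite mxE. Qed.

Lemma dotvDr (R : realType) n (x y z : 'cV[R]_n) :
  dotv x (y + z) = dotv x y + dotv x z.
Proof. by rewrite /dotv mulmxDr mxE. Qed.

Lemma dotvZr (R : realType) n a (x y : 'cV[R]_n) :
  dotv x (a *: y) = a * dotv x y.
Proof. by rewrite /dotv -scalemxAr mxE. Qed.

Lemma dotvC (R : realType) n (x y : 'cV[R]_n) : dotv x y = dotv y x.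
Proof. by rewrite !dotvE; apply: eq_bigr => j _; rewrite mulrC. Qed.

Lemma dotv_tr (R : realType) m n (A : 'M[R]_(m, n)) x y :
  dotv x (A *m y) = dotv (A^T *m x) y.
Proof. by rewrite /dotv trmx_mul trmxK mulmxA. Qed.

Lemma norm2_ge0 (R : realType) n (x : 'cV[R]_n) : 0 <= norm2 x.
Proof. exact: sqrtr_ge0. Qed.

Lemma sqr_norm2 (R : realType) n (x : 'cV[R]_n) :
  norm2 x ^+ 2 = \sum_(j < n) x j 0 ^+ 2.
Proof. by rewrite sqr_sqrtr// sumr_ge0// => j _; exact: sqr_ge0. Qed.

Lemma dotvv (R : realType) n (x : 'cV[R]_n) : dotv x x = norm2 x ^+ 2.
Proof. by rewrite sqr_norm2 dotvE; apply: eq_bigr => j _; rewrite expr2. Qed.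

Lemma norm2_eq0 (R : realType) n (x : 'cV[R]_n) : norm2 x = 0 -> x = 0.
Proof.
move=> x0; have := sqr_norm2 x; rewrite x0 expr0n /= => /esym/eqP.
rewrite psumr_eq0 => [/allP s0|j _]; last exact: sqr_ge0.
apply/matrixP => j k; rewrite ord1 mxE; apply/eqP.
by rewrite -sqrf_eq0; apply: s0; rewrite mem_index_enum.
Qed.

Lemma norm2_0 (R : realType) n : norm2 (0 : 'cV[R]_n) = 0.
Proof.
by apply/eqP; rewrite -sqrf_eq0 -dotvv dotvE big1// => j _; rewrite mxE mul0r.
Qed.

Lemma le_of_sqr_le (R : realType) (a b : R) :
  0 <= b -> a ^+ 2 <= b ^+ 2 -> a <= b.
Proof.
move=> b0 ab; have [a0|a0] := leP 0 a; first by rewrite -ler_sqr.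
by rewrite ltW// (lt_le_trans a0).
Qed.

(** Cauchy-Schwarz, from the squared norm of [<y, y> x - <x, y> y]. *)
Lemma dotv_le (R : realType) n (x y : 'cV[R]_n) :
  dotv x y <= norm2 x * norm2 y.
Proof.
apply: le_of_sqr_le; first by rewrite mulr_ge0 ?norm2_ge0.
rewrite exprMn -!dotvv.
have [y0|y0] := eqVneq (dotv y y) 0.
  suff -> : y = 0 by rewrite /dotv !mulmx0 !mxE mulr0 expr0n.
  by apply: norm2_eq0; apply/eqP; rewrite -sqrf_eq0 -dotvv y0.
have yp : 0 < dotv y y by rewrite lt_neqAle eq_sym y0 dotvv sqr_ge0.
rewrite -subr_ge0 -(pmulr_rge0 _ yp).
have := sqr_ge0 (norm2 (dotv y y *: x + (- dotv x y) *: y)).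
rewrite -dotvv !(dotvDr, dotvZr) ![dotv (_ + _) _]dotvC !(dotvDr, dotvZr).
by rewrite (dotvC y x); congr (0 <= _); ring.
Qed.

Lemma norm2D (R : realType) n (x y : 'cV[R]_n) :
  norm2 (x + y) <= norm2 x + norm2 y.
Proof.
apply: le_of_sqr_le; first by rewrite addr_ge0 ?norm2_ge0.
rewrite -dotvv dotvDr !(dotvC (x + y)) !dotvDr !dotvv (dotvC y x).
have := dotv_le x y; nra.
Qed.

Lemma norm2Z (R : realType) n a (x : 'cV[R]_n) :
  norm2 (a *: x) = `|a| * norm2 x.
Proof.
apply/eqP; rewrite -(@eqrXn2 _ 2) ?mulr_ge0 ?norm2_ge0//.
rewrite -dotvv dotvZr dotvC dotvZr dotvv exprMn real_normK ?num_real//.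
by apply/eqP; ring.
Qed.

Lemma norm2N (R : realType) n (x : 'cV[R]_n) : norm2 (- x) = norm2 x.
Proof. by rewrite -scaleN1r norm2Z normrN1 mul1r. Qed.

Lemma norm2B (R : realType) n (x y : 'cV[R]_n) :
  norm2 (x - y) <= norm2 x + norm2 y.
Proof. by rewrite -[norm2 y]norm2N norm2D. Qed.

(** Unlike the operator norm, the Frobenius norm is a finite sum, which makes
transposition, submultiplicativity and unitary invariance elementary; at a
fixed dimension the two are equivalent. *)
Definition frob (R : realType) m n (A : 'M[R]_(m, n)) : R := norm2 (mxvec A)^T.

Lemma frob_ge0 (R : realType) m n (A : 'M[R]_(m, n)) : 0 <= frob A.
Proof. exact: norm2_ge0. Qed.

Lemma sqr_frob (R : realType) m n (A : 'M[R]_(m, n)) :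
  frob A ^+ 2 = \sum_(j < m) \sum_(k < n) A j k ^+ 2.
Proof.
rewrite sqr_norm2 pair_bigA /= (reindex _ (curry_mxvec_bij _ _)) /=.
by apply: eq_bigr => -[j k] _ /=; rewrite mxE mxvecE.
Qed.

Lemma frob_tr (R : realType) m n (A : 'M[R]_(m, n)) : frob A^T = frob A.
Proof.
apply/eqP; rewrite -(@eqrXn2 _ 2) ?frob_ge0// !sqr_frob exchange_big.
by apply/eqP; apply: eq_bigr => j _; apply: eq_bigr => k _; rewrite mxE.
Qed.

Lemma frob_subC (R : realType) m n (A B : 'M[R]_(m, n)) :
  frob (A - B) = frob (B - A).
Proof. by rewrite /frob -opprB !linearN norm2N. Qed.

Lemma frobD (R : realType) m n (A B : 'M[R]_(m, n)) :
  frob (A + B) <= frob A + frob B.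
Proof. by rewrite /frob !linearD; apply: norm2D. Qed.

Lemma sqr_frob_tr (R : realType) m n (A : 'M[R]_(m, n)) :
  frob A ^+ 2 = \tr (A^T *m A).
Proof.
rewrite sqr_frob exchange_big /=; apply: eq_bigr => j _; rewrite mxE.
by apply: eq_bigr => k _; rewrite mxE expr2.
Qed.

(** Cauchy-Schwarz on each row. *)
Lemma norm2_mul (R : realType) m n (A : 'M[R]_(m, n)) x :
  norm2 (A *m x) <= frob A * norm2 x.
Proof.
apply: le_of_sqr_le; first by rewrite mulr_ge0 ?norm2_ge0.
rewrite exprMn sqr_frob sqr_norm2 mulr_suml; apply: ler_sum => j _.
have -> : (A *m x) j 0 = dotv (row j A)^T x.
  by rewrite dotvE mxE; apply: eq_bigr => k _; rewrite !mxE.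
have -> : \sum_k A j k ^+ 2 = norm2 (row j A)^T ^+ 2.
  by rewrite sqr_norm2; apply: eq_bigr => k _; rewrite !mxE.
rewrite -exprMn -[leLHS]real_normK ?num_real//.
rewrite ler_sqr ?nnegrE ?mulr_ge0 ?norm2_ge0//; set r := (row j A)^T.
rewrite ler_norml dotv_le andbT lerNl -[- _]mulN1r -dotvZr.
by rewrite (le_trans (dotv_le _ _))// norm2Z normrN1 mul1r.
Qed.

(** The Frobenius bound makes the set whose supremum is [opnorm2 A] bounded
above, without which the supremum would be meaningless. *)
Lemma norm2_le_opnorm2 (R : realType) m n (A : 'M[R]_(m, n)) x :
  norm2 x <= 1 -> norm2 (A *m x) <= opnorm2 A.
Proof.
move=> x1; apply: ub_le_sup; last by exists x.
exists (frob A) => _ [z /= z1 <-].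
by rewrite (le_trans (norm2_mul _ _))// ler_piMr ?frob_ge0.
Qed.

(** Each column is the image of a unit vector; the crude factor [n] in place
of [sqrt n] avoids a root. *)
Lemma frob_le_opnorm2 (R : realType) m n (A : 'M[R]_(m, n)) :
  frob A <= n%:R * opnorm2 A.
Proof.
have op0 : 0 <= opnorm2 A.
  by rewrite -(norm2_0 R m) -(mulmx0 1 A) norm2_le_opnorm2// norm2_0.
apply: le_of_sqr_le; first by rewrite mulr_ge0.
rewrite sqr_frob exchange_big /= exprMn.
apply: (@le_trans _ _ (\sum_(k < n) opnorm2 A ^+ 2)).
  apply: ler_sum => k _; have e1 : norm2 (delta_mx k 0 : 'cV[R]_n) = 1.
    apply/eqP; rewrite -(@eqrXn2 _ 2) ?norm2_ge0// sqr_norm2 expr1n.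
    rewrite (bigD1 k)//= mxE !eqxx expr1n big1 ?addr0// => j /negPf jk.
    by rewrite mxE jk expr0n.
  have := @norm2_le_opnorm2 _ _ _ A (delta_mx k 0); rewrite e1 => /(_ (lexx _)).
  move=> Ak; suff -> : \sum_i A i k ^+ 2 = norm2 (A *m delta_mx k 0) ^+ 2.
    by rewrite ler_sqr ?nnegrE ?norm2_ge0.
  by rewrite sqr_norm2; apply: eq_bigr => j _; rewrite -colE mxE.
rewrite sumr_const card_ord -[leLHS]mulr_natl ler_wpM2r ?sqr_ge0//.
by rewrite -natrX ler_nat; case: (n) => // k; rewrite leq_pmulr.
Qed.

Lemma norm2_orthonormal (R : realType) m n (Q : 'M[R]_(m, n)) x :
  orthonormal_columns Q -> norm2 (Q *m x) = norm2 x.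
Proof.
move=> QQ; apply/eqP; rewrite -(@eqrXn2 _ 2) ?norm2_ge0// -!dotvv dotv_tr.
by rewrite mulmxA QQ mul1mx.
Qed.

(** * Iterated Tikhonov filters on the image side *)

Lemma dotv_shifted_gram (R : realType) m n (A : 'M[R]_(m, n)) (a : R)
    (u : 'cV[R]_m) :
  dotv u ((A *m A^T + a%:M) *m u) = norm2 (A^T *m u) ^+ 2 + a * norm2 u ^+ 2.
Proof.
by rewrite mulmxDl dotvDr mul_scalar_mx dotvZr -mulmxA dotv_tr !dotvv.
Qed.

Lemma shifted_gram_unit (R : realType) m n (A : 'M[R]_(m, n)) (a : R) :
  0 < a -> A *m A^T + a%:M \in unitmx.
Proof.
move=> a0; rewrite -row_free_unit; apply: inj_row_free => v vM.
have M0 : (A *m A^T + a%:M) *m v^T = 0.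
  apply: trmx_inj; rewrite trmx_mul trmxK trmx0 linearD /= trmx_mul trmxK.
  by rewrite tr_scalar_mx.
have := dotv_shifted_gram A a v^T; rewrite M0 /dotv mulmx0 mxE => E.
suff /norm2_eq0 v0 : norm2 v^T = 0 by apply: trmx_inj; rewrite v0 trmx0.
apply/eqP; rewrite -sqrf_eq0 eq_le sqr_ge0 andbT -(pmulr_rle0 _ a0).
by have := sqr_ge0 (norm2 (A^T *m v^T)); lra.
Qed.

(** Pair [(A A^T + a) u] with [u] and apply Cauchy-Schwarz. The case [a = 0]
inverts [A A^T] on the vectors where [A^T] is bounded below; the case [a > 0]
bounds the resolvent there. *)
Lemma shifted_gram_lower_bound (R : realType) m n (A : 'M[R]_(m, n))
    (kap a : R) u :
  0 <= kap -> norm2 u ^+ 2 <= kap * norm2 (A^T *m u) ^+ 2 ->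
  (1 + kap * a) * norm2 u <= kap * norm2 ((A *m A^T + a%:M) *m u).
Proof.
move=> k0 uk; have := dotv_le u ((A *m A^T + a%:M) *m u).
rewrite dotv_shifted_gram; set s := norm2 (_ *m u) in uk *.
set r := norm2 (_ *m u); have [/eqP u0 _|u0 H] := boolP (norm2 u == 0).
  by rewrite u0 mulr0 mulr_ge0 ?norm2_ge0.
rewrite -(@ler_pM2r _ (norm2 u)) ?lt_neqAle ?norm2_ge0 1?eq_sym ?u0//.
have := ler_wpM2l k0 H; move: uk; lra.
Qed.

Lemma invmx_expr_comm (R : realType) m n (B : 'M[R]_(m, n)) (M : 'M[R]_m)
    (N : 'M[R]_n) k :
  M \in unitmx -> N \in unitmx -> M *m B = B *m N ->
  invmx M ^+ k *m B = B *m invmx N ^+ k.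
Proof.
move=> uM uN MB.
have comm1 : invmx M *m B = B *m invmx N.
  by rewrite -[LHS]mulmx1 -(mulmxV uN) mulmxA -(mulmxA _ B) -MB mulKmx.
elim: k => [|k IH]; first by rewrite !expr0 mul1mx mulmx1.
by rewrite !exprS -!mulmxE -mulmxA IH mulmxA comm1 !mulmxA.
Qed.

(** The filter [sum_k a^(k-1) (A A^T + a)^-k]. It acts on the data side, where
a lower bound for [A^T] is available on a subspace that contains the range of
[A]. *)
Definition dual_tikhonov (R : realType) m n (A : 'M[R]_(m, n)) (a : R) i :
    'M[R]_m :=
  \sum_(1 <= k < i.+1) a ^+ k.-1 *: invmx (A *m A^T + a%:M) ^+ k.

Definition tikhonov_residual (R : realType) m n (A : 'M[R]_(m, n)) (a : R) i :
    'M[R]_m :=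
  a ^+ i *: invmx (A *m A^T + a%:M) ^+ i.

(** [A^T] intertwines the resolvents of [A^T A] and [A A^T]. *)
Lemma iterated_tikhonov_dual (R : realType) n (A : 'M[R]_n) y (a : R) i :
  0 < a -> iterated_tikhonov A y a i = A^T *m (dual_tikhonov A a i *m y).
Proof.
move=> a0; rewrite /dual_tikhonov mulmx_suml mulmx_sumr; apply: eq_bigr => k _.
rewrite -!scalemxAl -scalemxAr; congr (_ *: _); rewrite mulmxA; congr (_ *m _).
apply: invmx_expr_comm.
- by have := shifted_gram_unit A^T a0; rewrite trmxK.
- exact: shifted_gram_unit.
by rewrite mulmxDl mulmxDr mulmxA mul_scalar_mx mul_mx_scalar.
Qed.

(** With [M = (A A^T + a)^-1] one has [A A^T M = 1 - a M], so the sum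
telescopes. *)
Lemma gram_dual_tikhonov (R : realType) m n (A : 'M[R]_(m, n)) (a : R) i :
  0 < a -> A *m A^T *m dual_tikhonov A a i = 1%:M - tikhonov_residual A a i.
Proof.
move=> a0; have uM := shifted_gram_unit A a0.
rewrite /dual_tikhonov /tikhonov_residual; set M := invmx _.
have KM : A *m A^T *m M = 1%:M - a *: M.
  apply/eqP; rewrite eq_sym subr_eq -mul_scalar_mx -mulmxDl mulmxV//.
rewrite mulmx_sumr big_add1 /=.
pose f k : 'M[R]_m := - (a ^+ k *: M ^+ k).
rewrite (eq_bigr (fun k => f k.+1 - f k)) => [|k _].
  by rewrite telescope_sumr// /f !expr0 scale1r opprK addrC.
rewrite /f -scalemxAr (exprS M) -mulmxE mulmxA KM mulmxBl mul1mx scalerBr.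
by rewrite opprK [RHS]addrC -scalemxAl scalerA exprSr.
Qed.

Lemma dual_tikhonov_comm (R : realType) m n (A : 'M[R]_(m, n))
    (P : 'M[R]_m) (a : R) i :
  0 < a -> P *m (A *m A^T) = A *m A^T *m P ->
  P *m dual_tikhonov A a i = dual_tikhonov A a i *m P.
Proof.
move=> a0 PA; have uM := shifted_gram_unit A a0.
rewrite mulmx_sumr mulmx_suml; apply: eq_bigr => k _.
rewrite -scalemxAl -scalemxAr (@invmx_expr_comm _ _ _ P _ _ k uM uM)//.
by rewrite mulmxDl mulmxDr PA mul_scalar_mx mul_mx_scalar.
Qed.

(** [P] commutes with the resolvent, so the iteration stays in the range of
[P], where each factor [a (A A^T + a)^-1] has norm at most 1 and at most [kap
a]. *)
Lemma tikhonov_residual_le (R : realType) m n (A : 'M[R]_(m, n)) (P : 'M[R]_m)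
    (kap a : R) i v :
    0 < a -> 0 <= kap -> P *m (A *m A^T) = A *m A^T *m P ->
    (forall u, P *m u = u -> norm2 u ^+ 2 <= kap * norm2 (A^T *m u) ^+ 2) ->
    P *m v = v ->
  norm2 (tikhonov_residual A a i *m v) <= norm2 v /\
  norm2 (tikhonov_residual A a i *m v) <= (kap * a) ^+ i * norm2 v.
Proof.
move=> a0 k0 PA Pk Pv; have uM := shifted_gram_unit A a0.
rewrite /tikhonov_residual; set M := invmx _.
have PM : P *m M = M *m P.
  have := (@invmx_expr_comm _ _ _ P _ _ 1 uM uM); rewrite expr1 => -> //.
  by rewrite mulmxDl mulmxDr PA mul_scalar_mx mul_mx_scalar.
have ka0 : 0 <= kap * a by rewrite mulr_ge0// ltW.
have step u : P *m u = u -> [/\ P *m (a *: M *m u) = a *: M *m u,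
    norm2 (a *: M *m u) <= norm2 u & norm2 (a *: M *m u) <= kap * a * norm2 u].
  move=> Pu; have PMu : P *m (M *m u) = M *m u by rewrite mulmxA PM -mulmxA Pu.
  have := shifted_gram_lower_bound a k0 (Pk _ PMu); rewrite mulKVmx// => H.
  have r0 := norm2_ge0 (M *m u); have s0 := norm2_ge0 u.
  split; rewrite -scalemxAl ?norm2Z ?(gtr0_norm a0); last 2 first.
  - have := dotv_shifted_gram A a (M *m u); rewrite mulKVmx// => E.
    have := dotv_le (M *m u) u; rewrite E => E'.
    have [/eqP ->|r1] := boolP (norm2 (M *m u) == 0); first by rewrite mulr0.
    rewrite -(@ler_pM2r _ (norm2 (M *m u))) ?lt_neqAle ?r0 1?eq_sym ?r1//.
    have := sqr_ge0 (norm2 (A^T *m (M *m u))); nra.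
  - have /(ler_wpM2l (ltW a0)) : norm2 (M *m u) <= kap * norm2 u.
      by rewrite (le_trans _ H)// ler_peMl// lerDl.
    by rewrite mulrCA mulrA.
  by rewrite -scalemxAr PMu.
suff [] : [/\ P *m (a ^+ i *: M ^+ i *m v) = a ^+ i *: M ^+ i *m v,
    norm2 (a ^+ i *: M ^+ i *m v) <= norm2 v
  & norm2 (a ^+ i *: M ^+ i *m v) <= (kap * a) ^+ i * norm2 v] by [].
elim: i => [|i [IH1 IH2 IH3]]; first by rewrite !expr0 scale1r mul1mx mul1r Pv.
have -> : a ^+ i.+1 *: M ^+ i.+1 *m v = a *: M *m (a ^+ i *: M ^+ i *m v).
  rewrite mulmxA -!scalemxAl -!scalemxAr -scalemxAl scalerA -exprS.
  by rewrite (exprS M) mulmxE.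
have [H1 H2 H3] := step _ IH1; split => //; first exact: le_trans IH2.
by rewrite (le_trans H3)// exprS -[leRHS]mulrA ler_wpM2l.
Qed.

(** * Perturbation of the minimal-norm solution *)

(** [u = (T Tdag)^T u = Tdag^T (T^T u)]. *)
Lemma moore_penrose_range_coercive (R : realType) n (T Tdag : 'M[R]_n) u :
  moore_penrose T Tdag -> T *m Tdag *m u = u ->
  norm2 u <= frob Tdag * norm2 (T^T *m u).
Proof.
move=> [_ _ sP _] Pu; rewrite -{1}Pu -sP trmx_mul -mulmxA.
by rewrite (le_trans (norm2_mul _ _))// frob_tr.
Qed.

(** The perturbation costs at most half of [norm2 u], which is absorbed on the
left; the bound holds on the range of [T], which contains that of [A] in the
application. *)
Lemma range_coercive_perturb (R : realType) n (T Tdag A : 'M[R]_n) (eta : R) u :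
    moore_penrose T Tdag -> frob (T - A) <= eta -> frob Tdag * eta <= 2^-1 ->
    T *m Tdag *m u = u ->
  norm2 u ^+ 2 <= (2 * frob Tdag) ^+ 2 * norm2 (A^T *m u) ^+ 2.
Proof.
move=> MP TA eta_small Pu; have t0 := frob_ge0 Tdag.
rewrite -exprMn ler_sqr ?nnegrE ?mulr_ge0 ?norm2_ge0//.
have H := moore_penrose_range_coercive MP Pu.
have E : T^T *m u = A^T *m u + (T - A)^T *m u.
  by rewrite -mulmxDl linearB /= addrC subrK.
have H1 : norm2 (T^T *m u) <= norm2 (A^T *m u) + eta * norm2 u.
  rewrite E (le_trans (norm2D _ _))// lerD2l (le_trans (norm2_mul _ _))//.
  by rewrite frob_tr ler_wpM2r ?norm2_ge0.
have := ler_wpM2l t0 H1; have := ler_wpM2r (norm2_ge0 u) eta_small; nra.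
Qed.

(** With [u] the dual iterate and [P = T Tdag], the error is [(T - A)^T z +
A^T (z - u)], and [z - u] is controlled by [A A^T (z - u)] because it lies in
the range of [P]. *)
Lemma iterated_tikhonov_error (R : realType) n (T Tdag A : 'M[R]_n)
    (y yd z : 'cV[R]_n) (a eta F : R) i :
    moore_penrose T Tdag -> T *m Tdag *m A = A -> 0 < a ->
    frob (T - A) <= eta -> frob Tdag * eta <= 2^-1 ->
    frob T <= F -> frob A <= F ->
    z = Tdag^T *m (Tdag *m y) ->
  norm2 (Tdag *m y - iterated_tikhonov A yd a i) <=
    eta * norm2 z + F * ((2 * frob Tdag) ^+ 2 *
      (2 * F * eta * norm2 z + norm2 (T *m Tdag *m (y - yd))
       + norm2 (tikhonov_residual A a i *m (T *m Tdag *m yd)))).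
Proof.
move=> MP PA a0 TA eta_small TF AF zE; have [TXT XTX sP sQ] := MP.
set P := T *m Tdag in PA sP *; set kap := (2 * frob Tdag) ^+ 2.
have AtP : A^T *m P = A^T by rewrite -sP -trmx_mul PA.
have PK : P *m (A *m A^T) = A *m A^T *m P by rewrite mulmxA PA -mulmxA AtP.
have PP : P *m P = P by rewrite mulmxA TXT.
set v := P *m yd; set u := dual_tikhonov A a i *m v.
have Pv : P *m v = v by rewrite mulmxA PP.
have Pu : P *m u = u by rewrite mulmxA dual_tikhonov_comm// -mulmxA Pv.
have Pz : P *m z = z by rewrite zE mulmxA -sP -trmx_mul /P (mulmxA Tdag) XTX.
have F0 : 0 <= F := le_trans (frob_ge0 _) TF.
have -> : iterated_tikhonov A yd a i = A^T *m u.
  rewrite iterated_tikhonov_dual// /u /v (mulmxA _ P) -dual_tikhonov_comm//.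
  by rewrite -(mulmxA P) (mulmxA _ P) AtP.
have Tz : T^T *m z = Tdag *m y by rewrite zE mulmxA -trmx_mul sQ mulmxA XTX.
(* Uses T T^T z = P y and the telescoped filter. *)
have Kzu : A *m A^T *m (z - u) = A *m ((A - T)^T *m z) + (A - T) *m (T^T *m z)
    + P *m (y - yd) + tikhonov_residual A a i *m v.
  rewrite mulmxBr /u (mulmxA (A *m A^T)) gram_dual_tikhonov// mulmxBl mul1mx.
  rewrite opprB [_ *m v - v]addrC addrA; congr (_ + _).
  rewrite Tz mulmxBr -/v addrA; congr (_ - _).
  rewrite linearB /= !mulmxBl Tz mulmxBr -mulmxA.
  by rewrite (addrA _ (A *m _)) subrK (mulmxA T) subrK.
have zu : norm2 (z - u) <= kap * norm2 (A *m A^T *m (z - u)).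
  have Pzu : P *m (z - u) = z - u by rewrite mulmxBr Pz Pu.
  have := shifted_gram_lower_bound 0 (sqr_ge0 _)
    (range_coercive_perturb MP TA eta_small Pzu).
  by rewrite mulr0 addr0 mul1r raddf0 addr0.
have AT : frob (A - T) <= eta by rewrite frob_subC.
have -> : Tdag *m y - A^T *m u = (T - A)^T *m z + A^T *m (z - u).
  by rewrite linearB /= mulmxBl mulmxBr addrA subrK Tz.
rewrite (le_trans (norm2D _ _))// lerD//.
  by rewrite (le_trans (norm2_mul _ _))// frob_tr ler_wpM2r ?norm2_ge0.
rewrite (le_trans (norm2_mul _ _))// frob_tr.
rewrite ler_pM ?frob_ge0 ?norm2_ge0// (le_trans zu)// ler_wpM2l ?sqr_ge0//.
rewrite Kzu (le_trans (norm2D _ _))// lerD2r (le_trans (norm2D _ _))// lerD2r.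
have -> : 2 * F * eta * norm2 z = F * (eta * norm2 z) + eta * (F * norm2 z).
  by ring.
rewrite (le_trans (norm2D _ _))// lerD// (le_trans (norm2_mul _ _))//.
  rewrite ler_pM ?frob_ge0 ?norm2_ge0// (le_trans (norm2_mul _ _))//.
  by rewrite frob_tr ler_wpM2r ?norm2_ge0.
rewrite ler_pM ?frob_ge0 ?norm2_ge0// (le_trans (norm2_mul _ _))//.
by rewrite frob_tr ler_wpM2r ?norm2_ge0.
Qed.

(** * Arnoldi data *)

Lemma invmx_diag_expr (R : realType) n (d : 'rV[R]_n) k :
  (forall j, 0 < d 0 j) ->
  invmx (diag_mx d) ^+ k = diag_mx (\row_j (d 0 j)^-1 ^+ k).
Proof.
move=> d0; have inv1 : invmx (diag_mx d) = diag_mx (\row_j (d 0 j)^-1).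
  have dd : diag_mx (\row_j (d 0 j)^-1) *m diag_mx d = 1%:M.
    rewrite mulmx_diag -diag_const_mx; congr diag_mx.
    by apply/rowP => j; rewrite !mxE mulVf ?gt_eqF.
  have [_ ud] := mulmx1_unit dd.
  by rewrite -[RHS]mulmx1 -(mulmxV ud) mulmxA dd mul1mx.
elim: k => [|k IH].
  rewrite expr0 -[LHS]/(1%:M) -diag_const_mx; congr diag_mx.
  by apply/rowP => j; rewrite !mxE expr0.
rewrite exprS IH inv1 -mulmxE mulmx_diag; congr diag_mx.
by apply/rowP => j; rewrite !mxE exprS.
Qed.

Lemma sqr_norm2_le_diag_form (R : realType) n (d : 'rV[R]_n) (M : R) k v :
  (forall j, 0 < d 0 j <= M) ->
  norm2 v ^+ 2 <= M ^+ k * (v^T *m invmx (diag_mx d) ^+ k *m v) 0 0.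
Proof.
move=> dM; rewrite invmx_diag_expr => [|j]; last by have /andP[] := dM j.
rewrite -mulmxA -[(_ *m _) 0 0]/(dotv v _) dotvE mulr_sumr sqr_norm2.
apply: ler_sum => j _; rewrite mul_diag_mx !mxE.
have /andP[d0 dj] := dM j.
rewrite (_ : M ^+ k * _ = (M / d 0 j) ^+ k * v j 0 ^+ 2); last first.
  by rewrite exprMn expr2; ring.
by rewrite ler_peMl ?sqr_ge0// exprn_ege1// ler_pdivlMr// mul1r.
Qed.

(** [Sg Sg^T] is diagonal, and its entries are at most the sum of all squared
entries of [Sg]. *)
Lemma sqr_norm2_le_svd_form (R : realType) l (Sg : 'M[R]_(l.+1, l))
    (a : R) k v :
    0 < a ->
    (forall (j : 'I_l.+1) (m : 'I_l), j != m :> nat -> Sg j m = 0) ->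
  norm2 v ^+ 2 <= (frob Sg ^+ 2 + a) ^+ k *
    (v^T *m invmx (Sg *m Sg^T + a%:M) ^+ k *m v) 0 0.
Proof.
move=> a0 offdiag; pose d : 'rV[R]_l.+1 := \row_j (\sum_m Sg j m ^+ 2 + a).
have -> : Sg *m Sg^T + a%:M = diag_mx d.
  apply/matrixP => j j'; rewrite !mxE; case: eqVneq => [<-|jj'].
    rewrite !mulr1n; congr (_ + _).
    by apply: eq_bigr => m _; rewrite mxE expr2.
  rewrite !mulr0n addr0 big1// => m _; rewrite mxE.
  have [jm|jm] := eqVneq (j : nat) m; last by rewrite (offdiag _ _ jm) mul0r.
  rewrite [Sg j' m]offdiag ?mulr0//; apply: contraNN jj' => /eqP j'm.
  by apply/eqP/val_inj; rewrite /= jm j'm.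
apply: sqr_norm2_le_diag_form => j; rewrite mxE lerD2r sqr_frob.
apply/andP; split.
  by rewrite ltr_wpDl// sumr_ge0// => m _; exact: sqr_ge0.
rewrite [leRHS](bigD1 j)//= lerDl sumr_ge0// => j' _.
by rewrite sumr_ge0// => m _; exact: sqr_ge0.
Qed.

Lemma drop_last_col_orthonormal (R : realType) n l (V : 'M[R]_(n, l.+1)) :
  orthonormal_columns V -> orthonormal_columns (drop_last_col V).
Proof.
move=> VV; apply/matrixP => j k; rewrite !mxE.
have /matrixP/(_ (widen_ord (leqnSn l) j) (widen_ord (leqnSn l) k)) := VV.
rewrite !mxE => E; rewrite -[RHS]E.
by apply: eq_bigr => r _; rewrite !mxE.
Qed.

Lemma orthonormal_mul (R : realType) m n p (Q : 'M[R]_(m, n))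
    (W : 'M[R]_(n, p)) :
  orthonormal_columns Q -> orthonormal_columns W ->
  orthonormal_columns (Q *m W).
Proof.
rewrite /orthonormal_columns => QQ WW.
by rewrite trmx_mul -mulmxA (mulmxA Q^T) QQ mul1mx.
Qed.

Lemma frob_orthonormal (R : realType) m n p q (Q : 'M[R]_(m, n))
    (B : 'M[R]_(n, p)) (W : 'M[R]_(q, p)) :
  orthonormal_columns Q -> orthonormal_columns W ->
  frob (Q *m B *m W^T) = frob B.
Proof.
rewrite /orthonormal_columns => QQ WW.
apply/eqP; rewrite -(@eqrXn2 _ 2) ?frob_ge0// !sqr_frob_tr.
rewrite mxtrace_mulC trmx_mul trmxK -!mulmxA (mulmxA W^T) WW mul1mx.
by rewrite mxtrace_mulC trmx_mul -!mulmxA QQ mulmx1 mxtrace_mulC.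
Qed.

Section Admissible.
Context (R : realType) (n : nat) (T : 'M[R]_n) (y : 'cV[R]_n) (E C : R).
Context (i : nat) (d : iat_data R n) (ad : admissible T y E C i d).

Lemma arnoldi_approx_range :
  d_T d = T *m (drop_last_col (d_V d) *m (drop_last_col (d_V d))^T).
Proof.
by rewrite /d_T /arnoldi_approx -(arnoldi_relation (adm_arnoldi ad)) mulmxA.
Qed.

(** The singular value decomposition of [H] carries over to that of the
Arnoldi approximation through the orthonormal columns of [V]. *)
Lemma arnoldi_approx_svd :
  exists (Q1 : 'M[R]_(n, (d_l d).+1)) (Q2 : 'M[R]_(n, d_l d)),
  [/\ orthonormal_columns Q1, orthonormal_columns Q2,
      d_T d = Q1 *m d_Sigma d *m Q2^T
    & d_yhat d = pid_mx (d_l d) *m (Q1^T *m d_y d)].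
Proof.
have [HE [UU SS] _ _ _] := adm_svd ad.
have VV := arnoldi_orthonormal (adm_arnoldi ad).
exists (d_V d *m d_U d), (drop_last_col (d_V d) *m d_S d); split.
- exact: orthonormal_mul.
- by apply: orthonormal_mul => //; exact: drop_last_col_orthonormal.
- by rewrite /d_T /arnoldi_approx HE trmx_mul !mulmxA.
- by rewrite /d_yhat trmx_mul !mulmxA.
Qed.

Lemma arnoldi_frob_Sigma : frob (d_Sigma d) = frob (d_T d).
Proof.
by have [Q1 [Q2 [q1 q2 -> _]]] := arnoldi_approx_svd; rewrite frob_orthonormal.
Qed.

(** The last row of [Sigma] vanishes, hence [Sigma^T] ignores the coordinate
that the truncation in [yhat] removes. *)
Lemma norm2_arnoldi_tr_le :
  norm2 ((d_T d)^T *m d_y d) <= frob (d_T d) * norm2 (d_yhat d).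
Proof.
rewrite -arnoldi_frob_Sigma.
have [Q1 [Q2 [q1 q2 -> ->]]] := arnoldi_approx_svd.
have SgP : (d_Sigma d)^T *m pid_mx (d_l d) = (d_Sigma d)^T.
  have [_ _ offdiag _ _] := adm_svd ad.
  apply: trmx_inj; rewrite trmx_mul trmxK tr_pid_mx; apply/matrixP => j k.
  rewrite mxE (bigD1 j)//= big1 => [|m mj]; last first.
    by rewrite mxE eq_sym (inj_eq val_inj) (negPf mj) mul0r.
  rewrite mxE eqxx addr0 /=; case: ltnP => [_|lj]; first by rewrite mul1r.
  by rewrite mul0r offdiag// gtn_eqF// (leq_trans (ltn_ord k)).
rewrite !trmx_mul trmxK -!mulmxA norm2_orthonormal// -{1}SgP -mulmxA.
by rewrite (le_trans (norm2_mul _ _))// frob_tr.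
Qed.

(** The spectral lower bound on the form in the equation that defines [alpha].
*)
Lemma arnoldi_alpha_bound :
  d_alpha d ^+ (2 * i + 1) * norm2 (d_yhat d) ^+ 2 <=
  (frob (d_T d) ^+ 2 + d_alpha d) ^+ (2 * i + 1) *
    (E * d_h d + C * d_delta d) ^+ 2.
Proof.
have [_ _ offdiag _ _] := adm_svd ad; have a0 := adm_alpha_gt0 ad.
rewrite -(adm_alpha ad) [leRHS]mulrCA -arnoldi_frob_Sigma.
rewrite ler_wpM2l ?exprn_ge0 ?(ltW a0)//.
exact: sqr_norm2_le_svd_form.
Qed.

Lemma admissible_ge0 : 0 <= d_h d /\ 0 <= d_delta d.
Proof.
by split; [exact: adm_h_ge0 ad | exact: le_trans (norm2_ge0 _) (adm_noise ad)].
Qed.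

Lemma admissible_frob : frob (T - d_T d) <= n%:R * d_h d.
Proof.
by rewrite (le_trans (frob_le_opnorm2 _))// ler_wpM2l//; exact: adm_h ad.
Qed.

End Admissible.

Lemma powR_le_eventually (R : realType) (r eps : R) : 0 < r -> 0 < eps ->
  exists2 e : R, 0 < e & forall s, 0 <= s -> s < e -> s `^ r <= eps.
Proof.
move=> r0 e0; exists (eps `^ r^-1); first exact: powR_gt0.
move=> s s0 se; have := ge0_ler_powR (ltW r0) s0 (powR_ge0 _ _) (ltW se).
by rewrite -powRrM mulVf ?gt_eqF// powRr1// ltW.
Qed.

(** The two powers of [(h + delta)^(2/(2i+1))] that occur: the one in the
parameter equation and the one in the error. *)
Lemma powR_expn (R : realType) (s : R) i : 0 <= s ->
  (s `^ (2 / (2 * i%:R + 1))) ^+ (2 * i + 1) = s ^+ 2 /\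
  (s `^ (2 / (2 * i%:R + 1))) ^+ i = s `^ (2 * i%:R / (2 * i%:R + 1)).
Proof.
move=> s0; have k0 : (2 * i%:R + 1 : R) != 0.
  by rewrite gt_eqF// ltr_wpDl// mulr_ge0.
rewrite -!powR_mulrn ?powR_ge0// -!powRrM; split; congr (_ `^ _).
  by rewrite natrD natrM; field.
by field.
Qed.

(** * Decay of the filter residual *)

(** Used with [D] a sum of constants, it yields several smallness conditions
on the noise from one threshold [D^-1]. *)
Lemma mul_le1_of_lt_inv (R : realType) (D c s : R) :
  0 < D -> 0 <= s -> c <= D -> s < D^-1 -> c * s <= 1.
Proof.
move=> D0 s0 cD sD; rewrite (le_trans (ler_wpM2r s0 cD))//.
by rewrite -ler_pdivlMl// mulr1 ltW.
Qed.

Lemma le_powR_le1 (R : realType) (s : R) i : 0 <= s -> s <= 1 ->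
  s <= s `^ (2 * i%:R / (2 * i%:R + 1)).
Proof.
move=> s0 s1; have [->|sn0] := eqVneq s 0; first exact: powR_ge0.
rewrite -{1}(powRr1 s0); apply: ger_powR.
  by rewrite lt_neqAle eq_sym sn0 s0.
have k0 : 0 < 2 * i%:R + 1 :> R by rewrite ltr_wpDl// mulr_ge0.
by rewrite ler_pdivrMr// mul1r lerDl.
Qed.

(** Taking [2i+1]-st roots gives [a <= m q (M + a)] with [q = s^(2/(2i+1))];
the term [m q a] is absorbed on the left. The constant [m = 1 + (k/c)^2] is at
least 1, so it bounds its own root. *)
Lemma parameter_rate (R : realType) (a M c s k : R) i :
    0 < a -> 0 <= M -> 0 < c -> 0 <= s ->
    a ^+ (2 * i + 1) * c ^+ 2 <= (M + a) ^+ (2 * i + 1) * (k * s) ^+ 2 ->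
    (1 + (k / c) ^+ 2) * s `^ (2 / (2 * i%:R + 1)) <= 2^-1 ->
  a <= 2 * (1 + (k / c) ^+ 2) * M * s `^ (2 / (2 * i%:R + 1)).
Proof.
move=> a0 M0 c0 s0; set m := 1 + _; set q := s `^ _ => H mq.
have q0 : 0 <= q by exact: powR_ge0.
have [qs _] := powR_expn i s0; rewrite -/q in qs.
have m1 : 1 <= m by rewrite lerDl sqr_ge0.
have m0 : 0 <= m by rewrite (le_trans _ m1).
have Ma : 0 <= M + a by rewrite addr_ge0// ltW.
suff : a <= m * q * (M + a).
  have : a * (m * q) <= a * 2^-1 by rewrite ler_wpM2l// ltW.
  lra.
have kc : k ^+ 2 <= m ^+ (2 * i + 1) * c ^+ 2.
  apply: (@le_trans _ _ (m * c ^+ 2)).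
    have c2 : 0 < c ^+ 2 by rewrite exprn_gt0.
    by rewrite -ler_pdivrMr// -expr_div_n lerDr.
  by rewrite ler_wpM2r ?sqr_ge0// addn1 exprS ler_peMr// exprn_ege1.
suff : a ^+ (2 * i + 1) * c ^+ 2 <= (m * q * (M + a)) ^+ (2 * i + 1) * c ^+ 2.
  rewrite ler_pM2r ?exprn_gt0// ler_pXn2r ?nnegrE ?addn1//; first exact: ltW.
  by rewrite !mulr_ge0.
apply: le_trans H _; rewrite !exprMn qs.
have -> : m ^+ (2 * i + 1) * s ^+ 2 * (M + a) ^+ (2 * i + 1) * c ^+ 2 =
  (M + a) ^+ (2 * i + 1) * (m ^+ (2 * i + 1) * c ^+ 2 * s ^+ 2) by ring.
by rewrite ler_wpM2l ?exprn_ge0// ler_wpM2r ?sqr_ge0.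
Qed.

Lemma admissible_frob_le (R : realType) n (T : 'M[R]_n) y (E C : R) i d :
  admissible T y E C i d -> n%:R * (d_h d + d_delta d) <= 1 ->
  frob (T - d_T d) <= n%:R * (d_h d + d_delta d) /\ frob (d_T d) <= frob T + 1.
Proof.
move=> ad ns; have [h0 dl0] := admissible_ge0 ad.
have TA : frob (T - d_T d) <= n%:R * (d_h d + d_delta d).
  by rewrite (le_trans (admissible_frob ad))// ler_wpM2l// lerDl.
split=> //; have := frobD T (d_T d - T); rewrite addrC subrK frob_subC => H.
by rewrite (le_trans H)// lerD2l (le_trans TA).
Qed.

(** [T^T y] and [A^T yd] differ by a quantity that vanishes with the noise,
and [norm2 (A^T yd)] is at most [frob A] times the norm of [yhat]. *)
Lemma norm2_yhat_lower_bound (R : realType) n (T : 'M[R]_n) y (E C : R) i d :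
    admissible T y E C i d -> n%:R * (d_h d + d_delta d) <= 1 ->
    2 * (n%:R * norm2 y + (frob T + 1)) * (d_h d + d_delta d)
      <= norm2 (T^T *m y) ->
  norm2 (T^T *m y) <= 2 * (frob T + 1) * norm2 (d_yhat d).
Proof.
move=> ad ns small; have [TA AF] := admissible_frob_le ad ns.
have [h0 dl0] := admissible_ge0 ad; have F0 := frob_ge0 T.
have /le_trans/(_ (ler_wpM2r (norm2_ge0 (d_yhat d)) AF)) :=
  norm2_arnoldi_tr_le ad.
have E1 : T^T *m y = (d_T d)^T *m d_y d
    + ((T - d_T d)^T *m y + (d_T d)^T *m (y - d_y d)).
  by rewrite mulmxBr linearB /= mulmxBl addrCA [_ *m d_y d + _]addrC !subrK.
have := norm2D ((d_T d)^T *m d_y d)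
  ((T - d_T d)^T *m y + (d_T d)^T *m (y - d_y d)); rewrite -E1.
have := norm2D ((T - d_T d)^T *m y) ((d_T d)^T *m (y - d_y d)).
have : norm2 ((T - d_T d)^T *m y) <= n%:R * (d_h d + d_delta d) * norm2 y.
  by rewrite (le_trans (norm2_mul _ _))// frob_tr ler_wpM2r ?norm2_ge0.
have : norm2 ((d_T d)^T *m (y - d_y d)) <= (frob T + 1) * (d_h d + d_delta d).
  rewrite (le_trans (norm2_mul _ _))// frob_tr ler_pM ?frob_ge0 ?norm2_ge0//.
  by rewrite (le_trans (adm_noise ad))// lerDr.
lra.
Qed.

(** If [T^T y = 0], the data [P yd] are pure noise. Otherwise the discrepancy
equation makes [alpha] of order [(h + delta)^(2/(2i+1))]. *)
Lemma residual_rate (R : realType) n (T Tdag : 'M[R]_n) y i :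
    moore_penrose T Tdag ->
  exists K e : R, [/\ 0 <= K, 0 < e & forall d,
    admissible T y (norm2 (Tdag *m y)) 1 i d -> d_h d + d_delta d < e ->
    norm2 (tikhonov_residual (d_T d) (d_alpha d) i *m (T *m Tdag *m d_y d))
      <= K * (d_h d + d_delta d) `^ (2 * i%:R / (2 * i%:R + 1))].
Proof.
move=> MP; have [TXT _ sP _] := MP; set P := T *m Tdag in sP *.
set E := norm2 _; set tau := frob Tdag; set kap := (2 * tau) ^+ 2.
have t0 : 0 <= tau := frob_ge0 _; have F0 := frob_ge0 T.
have k0 : 0 <= kap := sqr_ge0 _; have y0 := norm2_ge0 y.
have P0 := frob_ge0 P; have E0 : 0 <= E := norm2_ge0 _.
have filtered d : admissible T y E 1 i d ->
    n%:R * (d_h d + d_delta d) <= 1 ->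
    tau * (n%:R * (d_h d + d_delta d)) <= 2^-1 ->
    norm2 (tikhonov_residual (d_T d) (d_alpha d) i *m (P *m d_y d))
      <= norm2 (P *m d_y d) /\
    norm2 (tikhonov_residual (d_T d) (d_alpha d) i *m (P *m d_y d))
      <= (kap * d_alpha d) ^+ i * norm2 (P *m d_y d).
  move=> ad ns tns; have [TA _] := admissible_frob_le ad ns.
  apply: (@tikhonov_residual_le _ _ _ _ P) => //.
  - exact: adm_alpha_gt0 ad.
  - have PA : P *m d_T d = d_T d.
      by rewrite (arnoldi_approx_range ad) !mulmxA TXT.
    by rewrite mulmxA PA -mulmxA -sP -trmx_mul PA.
  - by move=> u; exact: range_coercive_perturb MP TA tns.
  - by rewrite mulmxA mulmxA TXT.
(* Pure noise: D collects the conditions n s <= 1, 2 tau n s <= 1 and s <= 1. *)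
have [Ty0|Tyn0] := eqVneq (T^T *m y) 0.
  have Py : P *m y = 0 by rewrite -sP trmx_mul -mulmxA Ty0 mulmx0.
  pose D : R := 1 + n%:R + 2 * tau * n%:R.
  have n0 : 0 <= n%:R :> R by [].
  have tn0 : 0 <= tau * n%:R by rewrite mulr_ge0.
  have D0 : 0 < D by rewrite /D; lra.
  exists (frob P), D^-1; split=> //; first by rewrite invr_gt0.
  move=> d ad sD; have [h0 dl0] := admissible_ge0 ad.
  have s0 : 0 <= d_h d + d_delta d by rewrite addr_ge0.
  have H c : c <= D -> c * (d_h d + d_delta d) <= 1.
    by move=> cD; exact: mul_le1_of_lt_inv sD.
  have [||b _] := filtered d ad.
  - by apply: H; rewrite /D; lra.
  - by have := H (2 * tau * n%:R); rewrite /D; lra.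
  rewrite (le_trans b)//.
  have -> : P *m d_y d = - (P *m (y - d_y d)) by rewrite mulmxBr Py sub0r opprK.
  rewrite norm2N (le_trans (norm2_mul _ _))// ler_wpM2l//.
  rewrite (le_trans (adm_noise ad))//.
  apply: (@le_trans _ _ (d_h d + d_delta d)); first by rewrite lerDr.
  apply: le_powR_le1 => //; rewrite -[leLHS]mul1r; apply: H; rewrite /D; lra.
have a0 : 0 < norm2 (T^T *m y).
  rewrite lt_neqAle norm2_ge0 andbT eq_sym; apply: contraNneq Tyn0 => H.
  by apply/eqP; exact: norm2_eq0.
set a := norm2 _ in a0.
pose F := frob T + 1; pose c := a / (2 * F).
have F1 : 1 <= F by rewrite lerDr.
have Fp : 0 <= F by lra.
have c0 : 0 < c by rewrite divr_gt0//; lra.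
pose m := 1 + ((E + 1) / c) ^+ 2.
have m1 : 1 <= m by rewrite lerDl sqr_ge0.
(* g s <= 1 is the smallness needed to keep yhat at distance c from 0. *)
pose g := 2 * (n%:R * norm2 y + F) / a.
have g0 : 0 <= g.
  by rewrite divr_ge0 ?(ltW a0)// mulr_ge0// addr_ge0 ?mulr_ge0//; lra.
pose D : R := 1 + n%:R + 2 * tau * n%:R + g.
have n0 : 0 <= n%:R :> R by [].
have tn0 : 0 <= tau * n%:R by rewrite mulr_ge0.
have D0 : 0 < D by rewrite /D; lra.
have r0 : 0 < 2 / (2 * i%:R + 1) :> R by rewrite divr_gt0// ltr_wpDl// mulr_ge0.
have mi0 : 0 < (2 * m)^-1 by rewrite invr_gt0; lra.
have [e e0 qe] := powR_le_eventually r0 mi0.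
exists ((kap * (2 * m * F ^+ 2)) ^+ i * (frob P * (norm2 y + 1))),
  (Num.min e D^-1).
have m0 : 0 <= m by lra.
split.
- apply: mulr_ge0; last by rewrite mulr_ge0 ?addr_ge0.
  by apply: exprn_ge0; rewrite !mulr_ge0 ?sqr_ge0.
- by rewrite lt_min e0 invr_gt0.
move=> d ad; rewrite lt_min => /andP[se sD]; have [h0 dl0] := admissible_ge0 ad.
have al0 := adm_alpha_gt0 ad.
set s := d_h d + d_delta d in se sD *.
have s0 : 0 <= s by rewrite addr_ge0.
have H x : x <= D -> x * s <= 1 by move=> xD; exact: mul_le1_of_lt_inv sD.
have s1 : s <= 1 by rewrite -[leLHS]mul1r; apply: H; rewrite /D; lra.
have ns : n%:R * s <= 1 by apply: H; rewrite /D; lra.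
have tns : tau * (n%:R * s) <= 2^-1.
  by have := H (2 * tau * n%:R); rewrite /D; lra.
have gs : 2 * (n%:R * norm2 y + F) * s <= a.
  have : g * s <= 1 by apply: H; rewrite /D; lra.
  by rewrite /g mulrAC ler_pdivrMr// mul1r.
have [_ AF] := admissible_frob_le ad ns.
have yhat_ge : c <= norm2 (d_yhat d).
  rewrite ler_pdivrMr; last by lra.
  by rewrite mulrC; exact: norm2_yhat_lower_bound ad ns gs.
have alpha_le : d_alpha d <= 2 * m * F ^+ 2 * s `^ (2 / (2 * i%:R + 1)).
  apply: (@parameter_rate _ _ (F ^+ 2) c s (E + 1)) => //;
    [exact: sqr_ge0| |]; last first.
    have mm : m * (2 * m)^-1 = 2^-1.
      by rewrite invfM mulrCA mulfV ?mulr1// gt_eqF// (lt_le_trans ltr01).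
    by rewrite -mm ler_wpM2l// qe.
  have c2 : c ^+ 2 <= norm2 (d_yhat d) ^+ 2.
    by rewrite ler_sqr ?nnegrE ?norm2_ge0// ltW.
  rewrite (le_trans (ler_wpM2l (exprn_ge0 _ (ltW al0)) c2))//.
  rewrite (le_trans (arnoldi_alpha_bound ad))//.
  have Fd0 := frob_ge0 (d_T d).
  apply: ler_pM; rewrite ?sqr_ge0 ?exprn_ge0 ?addr_ge0 ?sqr_ge0 ?(ltW al0)//.
    rewrite addn1 ler_pXn2r ?nnegrE ?addr_ge0 ?sqr_ge0 ?(ltW al0)// lerD2r.
    by rewrite ler_sqr ?nnegrE//; lra.
  have Ed := mulr_ge0 E0 dl0; have Eh := mulr_ge0 E0 h0.
  rewrite ler_sqr ?nnegrE ?mulr_ge0 ?addr_ge0 ?mul1r//.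
  by rewrite /s; lra.
have [_ b] := filtered d ad ns tns; rewrite (le_trans b)//.
have [_ <-] := powR_expn i s0; rewrite [leRHS]mulrAC -exprMn.
have ka0 : 0 <= kap * d_alpha d by rewrite mulr_ge0// ltW.
have ka : kap * d_alpha d <= kap * (2 * m * F ^+ 2) * s `^ (2 / (2 * i%:R + 1)).
  by rewrite -mulrA ler_wpM2l.
apply: ler_pM; rewrite ?norm2_ge0 ?exprn_ge0//.
  by rewrite lerXn2r ?nnegrE// (le_trans ka0).
rewrite (le_trans (norm2_mul _ _))// ler_wpM2l//.
have -> : d_y d = y - (y - d_y d) by rewrite opprB addrC subrK.
rewrite (le_trans (norm2B _ _))// lerD2l (le_trans (adm_noise ad))//.
by rewrite (le_trans _ s1)// lerDr.
Qed.

(** * Error rate and asymptotic statement *)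

(** Combination of the deterministic error bound with the residual rate; the
linear terms are dominated since the exponent is below 1. *)
Lemma iat_error_rate (R : realType) n (T Tdag : 'M[R]_n) y i :
    moore_penrose T Tdag ->
  exists K e : R, [/\ 0 <= K, 0 < e & forall d,
    admissible T y (norm2 (Tdag *m y)) 1 i d -> d_h d + d_delta d < e ->
    norm2 (Tdag *m y - d_x i d)
      <= K * (d_h d + d_delta d) `^ (2 * i%:R / (2 * i%:R + 1))].
Proof.
move=> MP; have [K [e [K0 e0 res]]] := residual_rate y i MP.
have [TXT _ _ _] := MP.
pose z := Tdag^T *m (Tdag *m y); pose F := frob T + 1.
pose kap := (2 * frob Tdag) ^+ 2; pose P := T *m Tdag.
have t0 := frob_ge0 Tdag; have n0 : 0 <= n%:R :> R by [].
have tn0 := mulr_ge0 t0 n0.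
have F0 : 0 <= F by rewrite addr_ge0 ?frob_ge0.
have k0 : 0 <= kap := sqr_ge0 _.
have P0 := frob_ge0 P; have z0 := norm2_ge0 z.
pose K1 := n%:R * norm2 z + F * (kap * (2 * F * n%:R * norm2 z + frob P + K)).
pose D : R := 1 + n%:R + 2 * frob Tdag * n%:R.
have D0 : 0 < D by rewrite /D; lra.
exists K1, (Num.min e D^-1); split.
- by rewrite /K1 !(addr_ge0, mulr_ge0)// frob_ge0.
- by rewrite lt_min e0 invr_gt0.
move=> d ad; rewrite lt_min => /andP[se sD]; have [h0 dl0] := admissible_ge0 ad.
have resd := res d ad se; set s := d_h d + d_delta d in se sD resd *.
have s0 : 0 <= s by rewrite addr_ge0.
have H x : x <= D -> x * s <= 1 by move=> xD; exact: mul_le1_of_lt_inv sD.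
have s1 : s <= 1 by rewrite -[leLHS]mul1r; apply: H; rewrite /D; lra.
have ns : n%:R * s <= 1 by apply: H; rewrite /D; lra.
have tns : frob Tdag * (n%:R * s) <= 2^-1.
  by have := H (2 * frob Tdag * n%:R); rewrite /D; lra.
have [TA AF] := admissible_frob_le ad ns.
have PA : T *m Tdag *m d_T d = d_T d.
  by rewrite (arnoldi_approx_range ad) !mulmxA TXT.
have TF : frob T <= F by rewrite lerDl.
have := iterated_tikhonov_error (d_y d) i MP PA (adm_alpha_gt0 ad) TA tns TF AF
  (erefl z).
move/le_trans; apply.
set sp := s `^ _ in resd *; have ssp : s <= sp by exact: le_powR_le1.
have Py : norm2 (P *m (y - d_y d)) <= frob P * sp.
  rewrite (le_trans (norm2_mul _ _))// ler_wpM2l// (le_trans (adm_noise ad))//.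
  by rewrite (le_trans _ ssp)// lerDr.
have nz : n%:R * s * norm2 z <= n%:R * norm2 z * sp.
  by rewrite mulrAC ler_wpM2l// mulr_ge0.
have -> : K1 * sp = n%:R * norm2 z * sp +
  F * (kap * (2 * F * (n%:R * norm2 z * sp) + frob P * sp + K * sp)).
  by rewrite /K1; ring.
rewrite lerD// ler_wpM2l// ler_wpM2l// lerD// lerD//.
by rewrite -mulrA ler_wpM2l// mulr_ge0.
Qed.

Lemma near_vanishing_noise (R : realType) n (T : 'M[R]_n) y (E C : R) i e
    (Q : iat_data R n -> Prop) : 0 < e ->
    (forall d, admissible T y E C i d -> d_h d + d_delta d < e -> Q d) ->
  \forall d \near vanishing_noise T y E C i, Q d.
Proof. by move=> e0 HQ; exists e => // d [ad sd]; exact: HQ. Qed.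

Lemma bigO_of_rate (R : realType) n (T : 'M[R]_n) y (E C : R) i (p K e : R)
    (f : iat_data R n -> R^o) :
    0 <= K -> 0 < e -> (forall d, 0 <= f d) ->
    (forall d, admissible T y E C i d -> d_h d + d_delta d < e ->
      f d <= K * (d_h d + d_delta d) `^ p) ->
  let F := vanishing_noise T y E C i in
  f =O_F (fun d => (d_h d + d_delta d) `^ p : R^o).
Proof.
move=> K0 e0 f0 fK F; apply/eqO_exP; exists (K + 1); first by rewrite ltr_wpDl.
apply: (near_vanishing_noise e0) => d ad sd /=.
rewrite (ger0_norm (f0 d)) (ger0_norm (powR_ge0 _ _)) (le_trans (fK d ad sd))//.
by rewrite ler_wpM2r ?powR_ge0// lerDl.
Qed.

Lemma littleo_of_rate (R : realType) n (T : 'M[R]_n) y (E C : R) i (p r K e : R)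
    (f : iat_data R n -> R^o) :
    0 <= r -> r < p -> 0 <= K -> 0 < e -> (forall d, 0 <= f d) ->
    (forall d, admissible T y E C i d -> d_h d + d_delta d < e ->
      f d <= K * (d_h d + d_delta d) `^ p) ->
  let F := vanishing_noise T y E C i in
  f =o_F (fun d => (d_h d + d_delta d) `^ r : R^o).
Proof.
move=> r0 rp K0 e0 f0 fK F; apply/eqoP => eps eps0.
have pr0 : 0 < p - r by rewrite subr_gt0.
have ek0 : 0 < eps / (K + 1) by rewrite divr_gt0// ltr_wpDl.
have [e' e'0 small] := powR_le_eventually pr0 ek0.
have m0 : 0 < Num.min e e' by rewrite lt_min e0.
apply: (near_vanishing_noise m0) => d ad /=; rewrite lt_min => /andP[sd sd'].
have [h0 dl0] := admissible_ge0 ad; have s0 := addr_ge0 h0 dl0.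
rewrite (ger0_norm (f0 d)) (ger0_norm (powR_ge0 _ _)) (le_trans (fK d ad sd))//.
have -> : p = (p - r) + r by rewrite subrK.
rewrite powRD; last by rewrite subrK gt_eqF// (le_lt_trans r0).
rewrite mulrA ler_wpM2r ?powR_ge0//.
apply: le_trans (ler_wpM2l K0 (small _ s0 sd')) _.
rewrite mulrCA ler_piMr ?(ltW eps0)// ler_pdivrMr ?ltr_wpDl// mul1r lerDl//.
Qed.

Unset Implicit Arguments.
Theorem proposition2 (R : realType) (n : nat) (T : 'M[R]_n)
    (y xdag w : 'cV[R]_n) (Tdag : 'M[R]_n) (i : nat) (nu rho : R)
    (hTdag : moore_penrose T Tdag)
    (hxdag : xdag = Tdag *m y)
    (hi : (1 <= i)%N)
    (hnu : 0 <= nu) (hrho : 0 < rho)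
    (hsource : source_condition T nu rho w xdag) :
  let C : R := 1 in
  let E : R := norm2 xdag in
  let F := vanishing_noise T y E C i in
  let err : iat_data R n -> R^o := fun d => norm2 (xdag - d_x i d) in
  [/\ nu = 0 ->
        err =o_F (fun=> 1 : R^o),
      0 < nu < 1 ->
        exists e1 e2 : iat_data R n -> R^o,
          [/\ err = e1 \+ e2,
              e1 =o_F (fun d => (d_h d + d_delta d)
                          `^ (2 * nu * i%:R / (2 * nu * i%:R + 1)) : R^o)
            & e2 =O_F (fun d => d_gamma T d `^ (2 * nu) * norm2 w : R^o)]
    & nu = 1 ->
        exists e1 e2 : iat_data R n -> R^o,
          [/\ err = e1 \+ e2,
              e1 =O_F (fun d => (d_h d + d_delta d)
                          `^ (2 * i%:R / (2 * i%:R + 1)) : R^o)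
            & e2 =O_F (fun d => d_gamma T d *
                          norm2 ((1%:M - d_proj d) *m T *m w) : R^o)]].
Proof.
move=> C E F err.
have [K [e [K0 e0]]] := iat_error_rate y i hTdag.
rewrite -hxdag -/E => rate.
have err0 d : 0 <= err d by exact: norm2_ge0.
have cst0 (g : iat_data R n -> R^o) : (fun=> 0 : R^o) =O_F g.
  apply/eqO_exP; exists 1 => //; apply: (near_vanishing_noise ltr01) => d _ _.
  by rewrite normr0 mul1r.
have errD0 : err = err \+ (fun=> 0).
  by apply/funext => d; rewrite /= addr0.
have i0 : 0 < i%:R :> R by rewrite ltr0n.
split.
(* nu = 0: the comparison function is the power of exponent 0. *)
- move=> _; have -> : (fun=> 1 : R^o) =
      (fun d : iat_data R n => (d_h d + d_delta d) `^ 0 : R^o).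
    by apply/funext => d; rewrite powRr0.
  apply: littleo_of_rate rate => //.
  by rewrite divr_gt0//; lra.
- move=> /andP[nu0 nu1]; exists err, (fun=> 0); split=> //.
  have ni0 : 0 < nu * i%:R by rewrite mulr_gt0.
  have nii : nu * i%:R < i%:R by rewrite gtr_pMl.
  apply: littleo_of_rate rate => //.
    by rewrite divr_ge0//; lra.
  rewrite ltr_pdivrMr; last by lra.
  by rewrite [ltRHS]mulrAC ltr_pdivlMr; [nra|lra].
- by move=> _; exists err, (fun=> 0); split=> //; exact: bigO_of_rate rate.
Qed.
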